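(* Let $f,g:\mathbb{R}\times\mathbb{R}\to\mathbb{R}$ be smooth functions of $(x,\alpha)$ and consider the one-dimensional quasilinear differential-algebraic equation $g(x,\alpha)\,\dot x=f(x,\alpha)$ with phase variable $x$ and parameter $\alpha$. Assume that $$f(0,0)=0,\quad g(0,0)=0,\quad f_x(0,0)\neq 0,\quad g_x(0,0)\neq 0,$$ and $$A:=\left(g_x f_\alpha-f_x g_\alpha\right)\big|_{(0,0)}\neq 0.$$ Then there exists an invertible change of coordinate $x\mapsto\eta$ (depending on $\alpha$) and parameter $\alpha\mapsto\beta$ which brings the equation near the origin to the normal form $$\eta\,\dot\eta=\beta+s\,\eta+O(\eta^2),\qquad s=\operatorname{sign}\frac{f_x(0,0)}{g_x(0,0)}\in\{+1,-1\}.$$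
   Context: Subscripts denote partial derivatives. ''Brings near the origin to the normal form'' means: there are a smooth parameter-dependent change of coordinate $x=X(\eta,\alpha)$ with $X(0,0)=0$, locally invertible in $\eta$ for each small $\alpha$, and a smooth change of parameter $\beta=B(\alpha)$ with $B(0)=0$, invertible near $\alpha=0$, such that for all small $\alpha$ the equation, rewritten in the variable $\eta$ in a neighbourhood of the origin (and after multiplying both sides by a nowhere vanishing function if needed), takes the stated form. The term $O(\eta^2)$ may depend smoothly on the parameter. *)

(* Defs.v *)
From Stdlib Require Export Reals.
From Coquelicot Require Export Coquelicot.

Open Scope R_scope.

(** [ex_diff_n h n x y] says that all partial derivatives of [h] of order at
    most [n] exist and are continuous at [(x, y)]; on an open set and for all
    [n] this is C^infinity. *)
Definition smooth2 (h : R -> R -> R) : Prop :=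
  forall x y n, ex_diff_n h n x y.

Definition smooth2_near (h : R -> R -> R) (x y : R) : Prop :=
  locally_2d (fun u v => forall n, ex_diff_n h n u v) x y.

Definition smooth_near (h : R -> R) (x : R) : Prop :=
  locally x (fun u => forall n, ex_derive_n h n u).

Definition partial1 (h : R -> R -> R) (x y : R) : R := Derive (fun z => h z y) x.
Definition partial2 (h : R -> R -> R) (x y : R) : R := Derive (fun z => h x z) y.

(** Functions are total; everything below only concerns germs at the origin. *)

(** [x = X eta alpha], with inverse [eta = Y x alpha]. The two neighbourhoods
    are uniform in [alpha], so every [X (., alpha)] with [alpha] small is
    invertible near the origin. *)
Definition coordinate_change (X : R -> R -> R) : Prop :=
  X 0 0 = 0 /\ smooth2_near X 0 0 /\
  exists Y : R -> R -> R,
    smooth2_near Y 0 0 /\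
    locally_2d (fun eta alpha => Y (X eta alpha) alpha = eta) 0 0 /\
    locally_2d (fun x alpha => X (Y x alpha) alpha = x) 0 0.

Definition parameter_change (B : R -> R) : Prop :=
  B 0 = 0 /\ smooth_near B 0 /\
  exists A : R -> R,
    smooth_near A 0 /\
    locally 0 (fun alpha => A (B alpha) = alpha) /\
    locally 0 (fun beta => B (A beta) = beta).

(** The quasilinear equation [lead x a * x' = rhs x a]. *)
Record qdae := Qdae { lead : R -> R -> R; rhs : R -> R -> R }.

(** Substituting [x = X eta alpha] with [alpha] constant in time gives
    [x' = partial1 X eta alpha * eta']. *)
Definition change_variable (X : R -> R -> R) (E : qdae) : qdae :=
  Qdae (fun eta alpha => lead E (X eta alpha) alpha * partial1 X eta alpha)
       (fun eta alpha => rhs E (X eta alpha) alpha).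

Definition multiply (m : R -> R -> R) (E : qdae) : qdae :=
  Qdae (fun x a => m x a * lead E x a) (fun x a => m x a * rhs E x a).

Definition change_parameter (B : R -> R) (E : qdae) : qdae :=
  Qdae (fun x a => lead E x (B a)) (fun x a => rhs E x (B a)).

Definition same_near_origin (E E' : qdae) : Prop :=
  locally_2d (fun x a => lead E x a = lead E' x a /\ rhs E x a = rhs E' x a) 0 0.

(** [E] is an equation in [(x, alpha)], [N] one in [(eta, beta)]. *)
Definition brought_near_origin_to (E N : qdae) : Prop :=
  exists (X : R -> R -> R) (B : R -> R) (m : R -> R -> R),
    coordinate_change X /\ parameter_change B /\
    smooth2_near m 0 0 /\ locally_2d (fun eta alpha => m eta alpha <> 0) 0 0 /\
    same_near_origin (multiply m (change_variable X E)) (change_parameter B N).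

(** A smooth term, of order [eta^2] uniformly for small [beta]. *)
Definition smooth_O_eta2 (r : R -> R -> R) : Prop :=
  smooth2_near r 0 0 /\
  exists C : R, locally_2d (fun eta beta => Rabs (r eta beta) <= C * eta ^ 2) 0 0.

Definition normal_form (s : R) (r : R -> R -> R) : qdae :=
  Qdae (fun eta _ => eta) (fun eta beta => beta + s * eta + r eta beta).

(* Main.v *)
Require Import Defs.
From Stdlib Require Import Reals Ranalysis5 Lra.
From Coquelicot Require Import Coquelicot.
Open Scope R_scope.

(** Let [p] be the zero curve of [g] given by the implicit function theorem.  In the
    variable [xi = x - p alpha] Hadamard's lemma gives [g = xi G] with [G 0 0 <> 0], so
    the equation is [xi xi' = f / G = b alpha + c alpha xi + xi^2 q], where [b 0 = 0],
    [b' 0 = A / g_x^2] and [c 0 = f_x / g_x].  Then [xi = s c(alpha) eta] and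
    [beta = b / c^2] give the normal form with remainder [eta^2 q]. *)

(** * Smooth functions of two variables *)

(** Under [xi = k eta] with [k] depending on the parameter alone, [xi xi'] gains the factor [k^2]
    and the linear term the factor [k], so division by [k^2] leaves the linear coefficient [c / k].
    Taking [k = s c] makes it [s], and [k 0 = |f_x / g_x| > 0] means that the change keeps
    orientation. The condition on [A] gives [b' 0 <> 0], which makes [beta = b / k^2] an invertible
    change of parameter. The obstacle is smoothness to all orders in both variables at once. Neither
    the quotient of [g] by [xi] nor the root [p] is visibly smooth: the first is therefore written
    as an integral, with no division, and the second gains its regularity from the differential
    equation that it satisfies. Functions of the parameter alone are treated as functions of two
    variables constant in the first, so that a single calculus serves for everything. The normal
    form lives in [(eta, beta)], so the remainder must be rewritten through the inverse of
    [beta]. *)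

(* The partial derivatives are quantified existentially so that closure properties are
   proved by exhibiting them; [U] is meant to be open. *)
Fixpoint Ck (U : R -> R -> Prop) (n : nat) (h : R -> R -> R) : Prop :=
  (forall x y, U x y -> continuity_2d_pt h x y) /\
  match n with
  | O => True
  | S m => exists h1 h2 : R -> R -> R,
      (forall x y, U x y ->
        is_derive (fun z => h z y) x (h1 x y) /\
        is_derive (fun z => h x z) y (h2 x y)) /\
      Ck U m h1 /\ Ck U m h2
  end.

Definition open_2d (U : R -> R -> Prop) : Prop :=
  forall x y, U x y -> locally_2d U x y.

Lemma Ck_continuity U n h x y : Ck U n h -> U x y -> continuity_2d_pt h x y.
Proof. destruct n; intros [H _]; auto. Qed.

(** The product, quotient and chain rules express a derivative through the undifferentiated
    functions too, which are then needed one order lower. *)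
Lemma Ck_pred U n h : Ck U (S n) h -> Ck U n h.
Proof.
  revert h; induction n as [|n IH]; intros h [Hc H].
  - split; auto.
  - destruct H as (h1 & h2 & Hd & H1 & H2).
    split; auto. exists h1, h2; auto.
Qed.

Lemma Ck_subset (U V : R -> R -> Prop) n h :
  (forall x y, U x y -> V x y) -> Ck V n h -> Ck U n h.
Proof.
  intros HUV; revert h; induction n as [|n IH]; intros h [Hc H].
  - split; auto.
  - destruct H as (h1 & h2 & Hd & H1 & H2).
    split; auto. exists h1, h2; auto.
Qed.

(** Openness of [U] upgrades equality on [U] to equality of germs, which is what a derivative sees.
    The derivative witnesses are kept, so only the top level has to be redone. *)
Lemma Ck_ext U n h h' :
  open_2d U -> (forall x y, U x y -> h x y = h' x y) -> Ck U n h -> Ck U n h'.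
Proof.
  intros HU Heq H.
  assert (Hloc : forall x y, U x y -> locally_2d (fun u v => h u v = h' u v) x y).
  { intros x y Hxy. apply locally_2d_impl with U; [|now apply HU].
    apply locally_2d_forall; auto. }
  assert (Hc : forall x y, U x y -> continuity_2d_pt h' x y).
  { intros x y Hxy. apply continuity_2d_pt_ext_loc with h; auto.
    now apply Ck_continuity with U n. }
  destruct n as [|n]; [now split|].
  destruct H as (_ & h1 & h2 & Hd & H1 & H2).
  split; auto. exists h1, h2; split; auto.
  intros x y Hxy. destruct (Hd x y Hxy) as [D1 D2]. split.
  - eapply is_derive_ext_loc, D1.
    exact (locally_2d_1d_const_y _ _ _ (Hloc x y Hxy)).
  - eapply is_derive_ext_loc, D2.
    exact (locally_2d_1d_const_x _ _ _ (Hloc x y Hxy)).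
Qed.

Lemma Ck_const U n c : Ck U n (fun _ _ => c).
Proof.
  revert c; induction n as [|n IH]; intros c; split; auto;
    try (intros; apply continuity_2d_pt_const).
  exists (fun _ _ => 0), (fun _ _ => 0); split; auto.
  intros; split; apply (is_derive_const (K := R_AbsRing) (V := R_NormedModule)).
Qed.

Lemma Ck_fst U n : Ck U n (fun x _ => x).
Proof.
  destruct n as [|n]; split; auto; try (intros; apply continuity_2d_pt_id1).
  exists (fun _ _ => 1), (fun _ _ => 0); split; [|split; apply Ck_const].
  intros; split; [apply (is_derive_id (K := R_AbsRing))
    | apply (is_derive_const (K := R_AbsRing) (V := R_NormedModule))].
Qed.

Lemma Ck_snd U n : Ck U n (fun _ y => y).
Proof.
  destruct n as [|n]; split; auto; try (intros; apply continuity_2d_pt_id2).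
  exists (fun _ _ => 0), (fun _ _ => 1); split; [|split; apply Ck_const].
  intros; split; [apply (is_derive_const (K := R_AbsRing) (V := R_NormedModule))
    | apply (is_derive_id (K := R_AbsRing))].
Qed.

Lemma Ck_plus U n h k : Ck U n h -> Ck U n k -> Ck U n (fun x y => h x y + k x y).
Proof.
  revert h k; induction n as [|n IH]; intros h k Hh Hk.
  - split; auto. intros x y Hxy.
    apply continuity_2d_pt_plus; eapply Ck_continuity; eauto.
  - split; [intros x y Hxy;
      apply continuity_2d_pt_plus; eapply Ck_continuity; eauto|].
    destruct Hh as (_ & h1 & h2 & Hd & H1 & H2).
    destruct Hk as (_ & k1 & k2 & Kd & K1 & K2).
    exists (fun x y => h1 x y + k1 x y), (fun x y => h2 x y + k2 x y).
    split; auto.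
    intros x y Hxy. destruct (Hd x y Hxy), (Kd x y Hxy).
    split; apply (is_derive_plus (K := R_AbsRing) (V := R_NormedModule)); auto.
Qed.

Lemma Ck_mult U n h k : Ck U n h -> Ck U n k -> Ck U n (fun x y => h x y * k x y).
Proof.
  revert h k; induction n as [|n IH]; intros h k Hh Hk.
  - split; auto. intros x y Hxy.
    apply continuity_2d_pt_mult; eapply Ck_continuity; eauto.
  - split; [intros x y Hxy;
      apply continuity_2d_pt_mult; eapply Ck_continuity; eauto|].
    generalize (Ck_pred _ _ _ Hh) (Ck_pred _ _ _ Hk); intros Hh' Hk'.
    destruct Hh as (_ & h1 & h2 & Hd & H1 & H2).
    destruct Hk as (_ & k1 & k2 & Kd & K1 & K2).
    exists (fun x y => h1 x y * k x y + h x y * k1 x y),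
      (fun x y => h2 x y * k x y + h x y * k2 x y).
    split; [|split; apply Ck_plus; auto].
    intros x y Hxy. destruct (Hd x y Hxy), (Kd x y Hxy). split.
    + apply (is_derive_mult (fun z => h z y) (fun z => k z y)); auto.
      intros; apply Rmult_comm.
    + apply (is_derive_mult (fun z => h x z) (fun z => k x z)); auto.
      intros; apply Rmult_comm.
Qed.

Lemma Ck_inv U n h :
  (forall x y, U x y -> h x y <> 0) -> Ck U n h -> Ck U n (fun x y => / h x y).
Proof.
  intros Hn; induction n as [|n IH]; intros Hh.
  - split; auto. intros x y Hxy.
    apply continuity_2d_pt_inv; auto; eapply Ck_continuity; eauto.
  - split; [intros x y Hxy;
      apply continuity_2d_pt_inv; auto; eapply Ck_continuity; eauto|].
    generalize (IH (Ck_pred _ _ _ Hh)); intros Hi.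
    destruct Hh as (_ & h1 & h2 & Hd & H1 & H2).
    (* The derivative [- h1 / h^2] is spelled as a product of constants, [h1] and inverses, so that
       [Ck_mult] and the induction hypothesis apply. *)
    exists (fun x y => -1 * h1 x y * (/ h x y * / h x y)),
      (fun x y => -1 * h2 x y * (/ h x y * / h x y)).
    split; [|split; repeat apply Ck_mult; auto using Ck_const].
    intros x y Hxy. destruct (Hd x y Hxy) as [D1 D2]. specialize (Hn x y Hxy).
    split.
    + replace (-1 * _ * _) with (- h1 x y / h x y ^ 2) by (field; auto).
      now apply (is_derive_inv (fun z => h z y)).
    + replace (-1 * _ * _) with (- h2 x y / h x y ^ 2) by (field; auto).
      now apply (is_derive_inv (fun z => h x z)).
Qed.

Lemma continuity_2d_pt_comp h u v x y :
  continuity_2d_pt h (u x y) (v x y) ->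
  continuity_2d_pt u x y -> continuity_2d_pt v x y ->
  continuity_2d_pt (fun x y => h (u x y) (v x y)) x y.
Proof.
  intros Hh Hu Hv eps. destruct (Hh eps) as [d Hd].
  generalize (locally_2d_and _ _ _ _ (Hu d) (Hv d)).
  apply locally_2d_impl, locally_2d_forall. intros a b [Ha Hb]; auto.
Qed.

(** The chain rule needs a total differential. Continuity at the point of one partial derivative is
    enough to obtain it. *)
Lemma differentiable_of_partials U h h1 h2 x y :
  open_2d U -> U x y ->
  (forall x y, U x y ->
    is_derive (fun z => h z y) x (h1 x y) /\ is_derive (fun z => h x z) y (h2 x y)) ->
  continuity_2d_pt h1 x y ->
  differentiable_pt_lim h x y (h1 x y) (h2 x y).
Proof.
  intros HU Hxy Hd Hc. apply filterdiff_differentiable_pt_lim.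
  eapply filterdiff_ext_lin.
  - apply (is_derive_filterdiff h x y h1 (h2 x y)).
    + apply (locally_2d_locally (fun a b => is_derive (fun z => h z b) a (h1 a b))).
      generalize (HU x y Hxy). apply locally_2d_impl, locally_2d_forall.
      intros a b Hab; now apply Hd.
    + now apply Hd.
    + now apply continuity_2d_pt_filterlim.
  - intros [a b]; reflexivity.
Qed.

Lemma Ck_comp U V n h u v :
  open_2d V -> (forall x y, U x y -> V (u x y) (v x y)) ->
  Ck V n h -> Ck U n u -> Ck U n v -> Ck U n (fun x y => h (u x y) (v x y)).
Proof.
  intros HV HUV; revert h u v HUV; induction n as [|n IH];
    intros h u v HUV Hh Hu Hv.
  - split; auto. intros x y Hxy.
    apply continuity_2d_pt_comp; eapply Ck_continuity; eauto.
  - split; [intros x y Hxy;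
      apply continuity_2d_pt_comp; eapply Ck_continuity; eauto|].
    generalize (Ck_pred _ _ _ Hu) (Ck_pred _ _ _ Hv); intros Hu' Hv'.
    destruct Hh as (_ & h1 & h2 & Hd & H1 & H2).
    destruct Hu as (_ & u1 & u2 & Ud & U1 & U2).
    destruct Hv as (_ & v1 & v2 & Vd & V1 & V2).
    exists (fun x y => h1 (u x y) (v x y) * u1 x y + h2 (u x y) (v x y) * v1 x y),
      (fun x y => h1 (u x y) (v x y) * u2 x y + h2 (u x y) (v x y) * v2 x y).
    split; [|split; apply Ck_plus; apply Ck_mult; auto].
    intros x y Hxy.
    assert (D : differentiable_pt_lim h (u x y) (v x y)
                  (h1 (u x y) (v x y)) (h2 (u x y) (v x y))).
    { apply differentiable_of_partials with V; auto.
      eapply Ck_continuity; eauto. }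
    destruct (Ud x y Hxy), (Vd x y Hxy).
    split; apply is_derive_Reals.
    + apply (derivable_pt_lim_comp_2d h (fun z => u z y) (fun z => v z y));
        auto; now apply is_derive_Reals.
    + apply (derivable_pt_lim_comp_2d h (fun z => u x z) (fun z => v x z));
        auto; now apply is_derive_Reals.
Qed.

(** The witnesses hidden in [Ck U n h] may change with [n]; uniqueness of derivatives identifies
    them all with [Derive], so one pair of functions serves every order. *)
Lemma Ck_partials U h :
  open_2d U -> (forall n, Ck U n h) ->
  (forall x y, U x y ->
    is_derive (fun z => h z y) x (partial1 h x y) /\
    is_derive (fun z => h x z) y (partial2 h x y)) /\
  (forall n, Ck U n (partial1 h)) /\ (forall n, Ck U n (partial2 h)).
Proof.
  intros HU H.
  assert (D : forall x y, U x y ->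
    is_derive (fun z => h z y) x (partial1 h x y) /\
    is_derive (fun z => h x z) y (partial2 h x y)).
  { intros x y Hxy. destruct (H 1%nat) as (_ & h1 & h2 & Hd & _).
    destruct (Hd x y Hxy). split; apply Derive_correct; eexists; eauto. }
  split; auto.
  split; intros n; destruct (H (S n)) as (_ & h1 & h2 & Hd & H1 & H2);
    [apply Ck_ext with h1 | apply Ck_ext with h2]; auto;
    intros x y Hxy; destruct (Hd x y Hxy); symmetry; now apply is_derive_unique.
Qed.

Lemma Ck_of_ex_diff_n U n h :
  (forall x y, U x y -> ex_diff_n h n x y) -> Ck U n h.
Proof.
  revert h; induction n as [|n IH]; intros h H.
  - split; auto. intros x y Hxy; now destruct (H x y Hxy).
  - split; [intros x y Hxy; now destruct (H x y Hxy)|].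
    exists (partial1 h), (partial2 h). split; [|split].
    + intros x y Hxy. destruct (H x y Hxy) as (_ & D1 & D2 & _).
      split; now apply Derive_correct.
    + apply IH. intros x y Hxy. apply (H x y Hxy).
    + apply IH. intros x y Hxy. apply (H x y Hxy).
Qed.

Lemma ex_diff_n_of_Ck U n h x y :
  open_2d U -> Ck U n h -> U x y -> ex_diff_n h n x y.
Proof.
  intros HU; revert h x y; induction n as [|n IH]; intros h x y H Hxy.
  - split; auto. now apply (Ck_continuity _ _ _ _ _ H).
  - destruct H as (Hc & h1 & h2 & Hd & H1 & H2).
    assert (Hloc := HU x y Hxy).
    destruct (Hd x y Hxy) as [D1 D2].
    split; auto. split; [eexists; apply D1|]. split; [eexists; apply D2|].
    split; [apply ex_diff_n_ext_loc with h1 | apply ex_diff_n_ext_loc with h2]; auto;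
      generalize Hloc; apply locally_2d_impl, locally_2d_forall;
      intros a b Hab; destruct (Hd a b Hab); symmetry; now apply is_derive_unique.
Qed.

(** These are the basic neighbourhoods behind [locally_2d] at the origin, and they contain the
    segment from [(0, y)] to each of their points [(x, y)], along which Hadamard's integral runs. *)
Definition square (d : R) (x y : R) : Prop := Rabs x < d /\ Rabs y < d.

Lemma open_square d : open_2d (square d).
Proof.
  intros x y [Hx Hy].
  assert (Hp : 0 < Rmin (d - Rabs x) (d - Rabs y)) by (apply Rmin_pos; lra).
  exists (mkposreal _ Hp); simpl. intros u v Hu Hv.
  assert (Hm1 := Rmin_l (d - Rabs x) (d - Rabs y)).
  assert (Hm2 := Rmin_r (d - Rabs x) (d - Rabs y)).
  assert (Ht1 := Rabs_triang (u - x) x). assert (Ht2 := Rabs_triang (v - y) y).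
  replace (u - x + x) with u in Ht1 by ring.
  replace (v - y + y) with v in Ht2 by ring.
  split; lra.
Qed.

Lemma locally_2d_square P :
  locally_2d P 0 0 <-> exists d : posreal, forall x y, square d x y -> P x y.
Proof.
  split; intros [d H]; exists d.
  - intros x y [Hx Hy]. apply H; now rewrite Rminus_0_r.
  - intros x y Hx Hy. rewrite Rminus_0_r in Hx, Hy. apply H; now split.
Qed.

(** * Hadamard's lemma *)

Lemma locally_2d_comp P u v x y :
  locally_2d P (u x y) (v x y) ->
  continuity_2d_pt u x y -> continuity_2d_pt v x y ->
  locally_2d (fun x y => P (u x y) (v x y)) x y.
Proof.
  intros [d Hd] Hu Hv.
  generalize (locally_2d_and _ _ _ _ (Hu d) (Hv d)).
  apply locally_2d_impl, locally_2d_forall. intros a b [Ha Hb]; auto.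
Qed.

(** For [n = 0] and [h] the first partial derivative of [k], this is Hadamard's quotient of
    [k x y - k 0 y] by [x], written without division. *)
Definition moment (n : nat) (h : R -> R -> R) (x y : R) : R :=
  RInt (fun t => t ^ n * h (t * x) y) 0 1.

Lemma square_scal d x y t : 0 <= t <= 1 -> square d x y -> square d (t * x) y.
Proof.
  intros Ht [Hx Hy]; split; auto.
  rewrite Rabs_mult, (Rabs_pos_eq t) by lra.
  assert (0 <= Rabs x) by apply Rabs_pos. nra.
Qed.

Lemma continuous_pow_scal d n h x y t :
  (forall x y, square d x y -> continuity_2d_pt h x y) ->
  square d x y -> 0 <= t <= 1 ->
  continuous (fun t => t ^ n * h (t * x) y) t.
Proof.
  intros Hc Hxy Ht.
  apply (continuous_mult (fun t => t ^ n) (fun t => h (t * x) y)).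
  - apply (ex_derive_continuous (fun t => t ^ n)). auto_derive; auto.
  - apply (continuous_comp_2 (fun t => t * x) (fun _ => y) h).
    + apply (ex_derive_continuous (fun t => t * x)). auto_derive; auto.
    + apply continuous_const.
    + apply (continuity_2d_pt_filterlim h (t * x) y).
      now apply Hc, square_scal.
Qed.

Lemma ex_RInt_moment d n h x y :
  (forall x y, square d x y -> continuity_2d_pt h x y) ->
  square d x y -> ex_RInt (fun t => t ^ n * h (t * x) y) 0 1.
Proof.
  intros Hc Hxy.
  apply (ex_RInt_continuous (V := R_CompleteNormedModule)).
  intros t Ht. rewrite Rmin_left, Rmax_right in Ht by lra.
  now apply continuous_pow_scal with d.
Qed.

Lemma continuity_2d_pt_moment d n h x y :
  (forall x y, square d x y -> continuity_2d_pt h x y) ->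
  square d x y -> continuity_2d_pt (moment n h) x y.
Proof.
  intros Hc Hxy eps.
  destruct Hxy as [Hx Hy].
  (* [rho] lies strictly between [Rabs x] and [d]: the compact segment stays in the square and still
     contains [t * u] for all [u] near [x] and [t] in [[0, 1]]. *)
  set (rho := (Rabs x + d) / 2).
  assert (Hseg : forall z, - rho <= z <= rho -> continuity_2d_pt h z y).
  { intros z Hz. apply Hc. split; auto.
    apply Rle_lt_trans with rho; [now apply Rabs_le|unfold rho; lra]. }
  (* Compactness gives one [del] for all [t]. Half of [eps] is used because the integral estimate
     below is non-strict. *)
  destruct (uniform_continuity_2d_1d h (- rho) rho y Hseg (pos_div_2 eps))
    as [del Hdel].
  assert (Hm : 0 < Rmin del (Rmin (rho - Rabs x) (d - Rabs y))).
  { repeat apply Rmin_pos; unfold rho; try lra. apply cond_pos. }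
  exists (mkposreal _ Hm); simpl. intros u v Hu Hv.
  assert (M1 := Rmin_l del (Rmin (rho - Rabs x) (d - Rabs y))).
  assert (M2 := Rmin_r del (Rmin (rho - Rabs x) (d - Rabs y))).
  assert (M3 := Rmin_l (rho - Rabs x) (d - Rabs y)).
  assert (M4 := Rmin_r (rho - Rabs x) (d - Rabs y)).
  assert (Tu := Rabs_triang (u - x) x). replace (u - x + x) with u in Tu by ring.
  assert (Tv := Rabs_triang (v - y) y). replace (v - y + y) with v in Tv by ring.
  assert (Huv : square d u v) by (split; unfold rho in *; lra).
  unfold moment.
  assert (E1 := ex_RInt_moment d n h u v Hc Huv).
  assert (E2 := ex_RInt_moment d n h x y Hc (conj Hx Hy)).
  assert (Eq := RInt_minus (V := R_CompleteNormedModule) _ _ 0 1 E1 E2).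
  assert (Em := ex_RInt_minus (V := R_NormedModule) _ _ 0 1 E1 E2).
  unfold minus, plus, opp in Eq, Em; simpl in Eq, Em.
  unfold Rminus at 1. rewrite <- Eq.
  apply Rle_lt_trans with ((1 - 0) * (eps / 2)).
  2: destruct eps; simpl; lra.
  apply abs_RInt_le_const; auto; try lra.
  intros t Ht.
  replace (t ^ n * h (t * u) v + - (t ^ n * h (t * x) y))
    with (t ^ n * (h (t * u) v - h (t * x) y)) by ring.
  rewrite Rabs_mult.
  assert (P1 : Rabs (t ^ n) <= 1).
  { rewrite Rabs_pos_eq by (apply pow_le; lra).
    rewrite <- (pow1 n). apply pow_incr; lra. }
  assert (S : forall z, Rabs z < rho -> - rho <= t * z <= rho).
  { intros z Hz. apply Rabs_le_between.
    rewrite Rabs_mult, (Rabs_pos_eq t) by lra.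
    assert (0 <= Rabs z) by apply Rabs_pos. nra. }
  assert (P2 : Rabs (h (t * u) v - h (t * x) y) < eps / 2).
  { assert (0 < del) by apply cond_pos.
    apply Hdel; auto; try lra.
    - apply S; unfold rho; lra.
    - apply S; lra.
    - apply Rabs_lt_between' in Hv. lra.
    - rewrite <- Rmult_minus_distr_l, Rabs_mult, (Rabs_pos_eq t) by lra.
      assert (0 <= Rabs (u - x)) by apply Rabs_pos. nra. }
  assert (0 <= Rabs (t ^ n)) by apply Rabs_pos.
  assert (0 <= Rabs (h (t * u) v - h (t * x) y)) by apply Rabs_pos. nra.
Qed.

Lemma is_derive_moment_1 d n h h1 x y :
  (forall x y, square d x y -> continuity_2d_pt h x y) ->
  (forall x y, square d x y -> continuity_2d_pt h1 x y) ->
  (forall x y, square d x y -> is_derive (fun z => h z y) x (h1 x y)) ->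
  square d x y ->
  is_derive (fun z => moment n h z y) x (moment (S n) h1 x y).
Proof.
  intros Hc Hc1 Hd Hxy. unfold moment.
  (* The condition is on [t * u] and not on [t], since joint continuity at [t = 0] or [t = 1] also
     looks at [t] outside [[0, 1]]. *)
  assert (D : forall u t, square d (t * u) y ->
    is_derive (fun u => t ^ n * h (t * u) y) u (t ^ S n * h1 (t * u) y)).
  { intros u t Hut.
    replace (t ^ S n * h1 (t * u) y) with (t ^ n * (t * h1 (t * u) y)) by (simpl; ring).
    apply (is_derive_scal (fun u => h (t * u) y)).
    apply (is_derive_comp (fun z => h z y) (fun u => t * u)); [now apply Hd|].
    auto_derive; auto; ring. }
  assert (L : locally x (fun u => square d u y)).
  { apply (locally_2d_1d_const_y (square d)). now apply open_square. }
  replace (RInt (fun t => t ^ S n * h1 (t * x) y) 0 1)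
    with (RInt (fun t => Derive (fun u => t ^ n * h (t * u) y) x) 0 1).
  2: { apply RInt_ext. intros t Ht. rewrite Rmin_left, Rmax_right in Ht by lra.
       apply is_derive_unique, D, square_scal; auto; lra. }
  apply (is_derive_RInt_param (fun u t => t ^ n * h (t * u) y)).
  - generalize L; apply filter_imp. intros u Hu t Ht.
    rewrite Rmin_left, Rmax_right in Ht by lra.
    eexists; apply D, square_scal; auto.
  - intros t Ht. rewrite Rmin_left, Rmax_right in Ht by lra.
    assert (C : continuity_2d_pt (fun u t => t * u) x t).
    { apply continuity_2d_pt_mult;
        [apply continuity_2d_pt_id2|apply continuity_2d_pt_id1]. }
    apply continuity_2d_pt_ext_loc with (fun u t => t ^ S n * h1 (t * u) y).
    + assert (Lo : locally_2d (fun u t => square d (t * u) y) x t).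
      { apply (locally_2d_comp (square d) (fun u t => t * u) (fun _ _ => y)); auto.
        - now apply open_square, square_scal.
        - apply continuity_2d_pt_const. }
      generalize Lo; apply locally_2d_impl, locally_2d_forall.
      intros u s Hus. symmetry. now apply is_derive_unique, D.
    + apply continuity_2d_pt_mult.
      * apply (continuity_1d_2d_pt_comp (fun t => t ^ S n) (fun _ t => t)).
        -- apply derivable_continuous_pt, derivable_pt_pow.
        -- apply continuity_2d_pt_id2.
      * apply (continuity_2d_pt_comp h1 (fun u t => t * u) (fun _ _ => y)); auto.
        -- now apply Hc1, square_scal.
        -- apply continuity_2d_pt_const.
  - generalize L; apply filter_imp. intros u Hu.
    now apply ex_RInt_moment with d.
Qed.

Lemma is_derive_moment_2 d n h h2 x y :
  (forall x y, square d x y -> continuity_2d_pt h x y) ->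
  (forall x y, square d x y -> continuity_2d_pt h2 x y) ->
  (forall x y, square d x y -> is_derive (fun z => h x z) y (h2 x y)) ->
  square d x y ->
  is_derive (fun z => moment n h x z) y (moment n h2 x y).
Proof.
  intros Hc Hc2 Hd Hxy. unfold moment.
  assert (D : forall v t, square d (t * x) v ->
    is_derive (fun v => t ^ n * h (t * x) v) v (t ^ n * h2 (t * x) v)).
  { intros v t Hvt. apply (is_derive_scal (fun v => h (t * x) v)). now apply Hd. }
  assert (L : locally y (fun v => square d x v)).
  { apply (locally_2d_1d_const_x (square d)). now apply open_square. }
  replace (RInt (fun t => t ^ n * h2 (t * x) y) 0 1)
    with (RInt (fun t => Derive (fun v => t ^ n * h (t * x) v) y) 0 1).
  2: { apply RInt_ext. intros t Ht. rewrite Rmin_left, Rmax_right in Ht by lra.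
       apply is_derive_unique, D, square_scal; auto; lra. }
  apply (is_derive_RInt_param (fun v t => t ^ n * h (t * x) v)).
  - generalize L; apply filter_imp. intros v Hv t Ht.
    rewrite Rmin_left, Rmax_right in Ht by lra.
    eexists; apply D, square_scal; auto.
  - intros t Ht. rewrite Rmin_left, Rmax_right in Ht by lra.
    assert (C : continuity_2d_pt (fun _ t => t * x) y t).
    { apply continuity_2d_pt_mult;
        [apply continuity_2d_pt_id2|apply continuity_2d_pt_const]. }
    apply continuity_2d_pt_ext_loc with (fun v t => t ^ n * h2 (t * x) v).
    + assert (Lo : locally_2d (fun v t => square d (t * x) v) y t).
      { apply (locally_2d_comp (square d) (fun v t => t * x) (fun v _ => v)); auto.
        - now apply open_square, square_scal.
        - apply continuity_2d_pt_id1. }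
      generalize Lo; apply locally_2d_impl, locally_2d_forall.
      intros v s Hvs. symmetry. now apply is_derive_unique, D.
    + apply continuity_2d_pt_mult.
      * apply (continuity_1d_2d_pt_comp (fun t => t ^ n) (fun _ t => t)).
        -- apply derivable_continuous_pt, derivable_pt_pow.
        -- apply continuity_2d_pt_id2.
      * apply (continuity_2d_pt_comp h2 (fun v t => t * x) (fun v _ => v)); auto.
        -- now apply Hc2, square_scal.
        -- apply continuity_2d_pt_id1.
  - generalize L; apply filter_imp. intros v Hv.
    now apply ex_RInt_moment with d.
Qed.

(* The weights [t ^ n] make the family of moments stable under both partial
   derivatives. *)
Lemma Ck_moment d k n h : Ck (square d) k h -> Ck (square d) k (moment n h).
Proof.
  revert n h; induction k as [|k IH]; intros n h Hh.
  - split; auto. intros x y Hxy. apply continuity_2d_pt_moment with d; auto.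
    intros; eapply Ck_continuity; eauto.
  - assert (Hc : forall x y, square d x y -> continuity_2d_pt h x y)
      by (intros; eapply Ck_continuity; eauto).
    split; [intros; now apply continuity_2d_pt_moment with d|].
    destruct Hh as (_ & h1 & h2 & Hd & H1 & H2).
    exists (moment (S n) h1), (moment n h2). split; [|split; auto].
    intros x y Hxy. split.
    + apply is_derive_moment_1 with d; auto.
      * intros; eapply Ck_continuity; eauto.
      * intros; now apply Hd.
    + apply is_derive_moment_2 with d; auto.
      * intros; eapply Ck_continuity; eauto.
      * intros; now apply Hd.
Qed.

(** Fundamental theorem of calculus for [t] mapped to [h (t * x) y] on [[0, 1]]. *)
Lemma moment_0_spec d h h1 x y :
  (forall x y, square d x y -> continuity_2d_pt h1 x y) ->
  (forall x y, square d x y -> is_derive (fun z => h z y) x (h1 x y)) ->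
  square d x y -> h x y = h 0 y + x * moment 0 h1 x y.
Proof.
  intros Hc Hd Hxy.
  assert (I : is_RInt (fun t => x * (t ^ 0 * h1 (t * x) y)) 0 1
                (minus (h (1 * x) y) (h (0 * x) y))).
  { apply (is_RInt_derive (fun t => h (t * x) y)).
    - intros t Ht. rewrite Rmin_left, Rmax_right in Ht by lra.
      replace (x * (t ^ 0 * h1 (t * x) y)) with (x * h1 (t * x) y) by (simpl; ring).
      apply (is_derive_comp (fun z => h z y) (fun t => t * x)).
      + now apply Hd, square_scal.
      + auto_derive; auto; ring.
    - intros t Ht. rewrite Rmin_left, Rmax_right in Ht by lra.
      apply (continuous_scal_r x (fun t => t ^ 0 * h1 (t * x) y)).
      now apply continuous_pow_scal with d. }
  assert (J := RInt_correct (V := R_CompleteNormedModule) _ _ _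
                 (ex_RInt_moment d 0 h1 x y Hc Hxy)).
  apply (is_RInt_scal (V := R_NormedModule) _ _ _ x) in J.
  assert (U := is_RInt_unique (V := R_CompleteNormedModule) _ _ _ _ I).
  assert (V := is_RInt_unique (V := R_CompleteNormedModule) _ _ _ _ J).
  unfold scal, minus, plus, opp in *; simpl in *; unfold mult in *; simpl in *.
  rewrite U in V. rewrite Rmult_1_l, Rmult_0_l in V.
  unfold moment; simpl. rewrite <- V. ring.
Qed.

Lemma moment_0_at_0 h y : moment 0 h 0 y = h 0 y.
Proof.
  unfold moment. rewrite (RInt_ext _ (fun _ => h 0 y)).
  - rewrite RInt_const. unfold scal; simpl; unfold mult; simpl. ring.
  - intros t _. rewrite Rmult_0_r; simpl; ring.
Qed.

(** * The implicit function theorem *)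

Lemma continuity_2d_pt_pos h x y :
  continuity_2d_pt h x y -> 0 < h x y -> locally_2d (fun u v => 0 < h u v) x y.
Proof.
  intros Hc Hp. generalize (Hc (mkposreal _ Hp)).
  apply locally_2d_impl, locally_2d_forall. simpl. intros u v H.
  apply Rabs_lt_between' in H. lra.
Qed.

Lemma square_increasing d h h1 x x' y :
  (forall x y, square d x y -> is_derive (fun z => h z y) x (h1 x y)) ->
  (forall x y, square d x y -> 0 < h1 x y) ->
  square d x y -> square d x' y -> x < x' -> h x y < h x' y.
Proof.
  intros Hd Hp [Hx Hy] [Hx' _] Hlt.
  assert (S : forall c, x <= c <= x' -> square d c y).
  { intros c Hc. split; auto. apply Rabs_lt_between in Hx, Hx'.
    apply Rabs_lt_between. lra. }
  destruct (MVT_gen (fun z => h z y) x x' (fun z => h1 z y)) as (c & Hc & E).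
  - rewrite Rmin_left, Rmax_right by lra. intros c Hc. apply Hd, S; lra.
  - rewrite Rmin_left, Rmax_right by lra. intros c Hc.
    apply derivable_continuous_pt. exists (h1 c y). now apply is_derive_Reals, Hd, S.
  - rewrite Rmin_left, Rmax_right in Hc by lra.
    assert (0 < h1 c y) by (apply Hp, S; lra). nra.
Qed.

(** Monotonicity in [x] gives [h] opposite signs at [d / 2] and [- d / 2] when the parameter is 0.
    Both signs persist for small [a], and the intermediate value theorem yields the root. *)
Lemma implicit_exists (d : posreal) h h1 :
  (forall x y, square d x y -> continuity_2d_pt h x y) ->
  (forall x y, square d x y -> is_derive (fun z => h z y) x (h1 x y)) ->
  (forall x y, square d x y -> 0 < h1 x y) ->
  h 0 0 = 0 ->
  exists (d' : posreal) (p : R -> R), d' <= d /\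
    forall a, Rabs a < d' -> Rabs (p a) < d /\ h (p a) a = 0.
Proof.
  intros Hc Hd Hp H0.
  assert (Pd := cond_pos d).
  set (e := d / 2).
  assert (He : forall x, - e <= x <= e -> Rabs x < d).
  { intros x Hx. apply Rabs_lt_between. unfold e in Hx. lra. }
  assert (S0 : forall x, - e <= x <= e -> square d x 0).
  { intros x Hx. split; auto. rewrite Rabs_R0; lra. }
  assert (E1 : 0 < h e 0).
  { apply Rle_lt_trans with (h 0 0); [lra|]. apply square_increasing with d h1; auto;
      try apply S0; unfold e; lra. }
  assert (E2 : h (- e) 0 < 0).
  { apply Rlt_le_trans with (h 0 0); [|lra]. apply square_increasing with d h1; auto;
      try apply S0; unfold e; lra. }
  assert (L1 : locally 0 (fun a => 0 < h e a)).
  { apply (locally_2d_1d_const_x (fun x a => 0 < h x a)), continuity_2d_pt_pos; auto.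
    apply Hc, S0; unfold e; lra. }
  assert (L2 : locally 0 (fun a => 0 < - h (- e) a)).
  { apply (locally_2d_1d_const_x (fun x a => 0 < - h x a)).
    apply (continuity_2d_pt_pos (fun x a => - h x a)); [|lra].
    apply continuity_2d_pt_opp, Hc, S0; unfold e; lra. }
  destruct L1 as [d1 L1], L2 as [d2 L2].
  assert (Hm : 0 < Rmin d (Rmin d1 d2)).
  { repeat apply Rmin_pos; apply cond_pos. }
  assert (M1 := Rmin_l d (Rmin d1 d2)). assert (M2 := Rmin_r d (Rmin d1 d2)).
  assert (M3 := Rmin_l d1 d2). assert (M4 := Rmin_r d1 d2).
  exists (mkposreal _ Hm); simpl.
  (* A sigma type, so that [p] is obtained by projection without a choice principle; for large [a]
     the value 0 is a dummy. *)
  assert (I : forall a, {x | Rabs a < Rmin d (Rmin d1 d2) -> Rabs x < d /\ h x a = 0}).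
  { intros a. destruct (Rlt_dec (Rabs a) (Rmin d (Rmin d1 d2))) as [Ha|Ha].
    2: exists 0; intros; contradiction.
    assert (B : forall r : posreal, Rabs a < r -> ball 0 r a).
    { intros r Hr. unfold ball; simpl; unfold AbsRing_ball, abs, minus, plus, opp; simpl.
      now rewrite Ropp_0, Rplus_0_r. }
    assert (F1 : 0 < h e a) by (apply L1, B; lra).
    assert (F2 : 0 < - h (- e) a) by (apply L2, B; lra).
    destruct (IVT_interv (fun x => h x a) (- e) e) as (z & Hz & Ez);
      try (unfold e; lra); try lra.
    - intros x Hx. apply derivable_continuous_pt. exists (h1 x a).
      apply is_derive_Reals, Hd. split; [now apply He|lra].
    - exists z; auto. }
  exists (fun a => proj1_sig (I a)). split; [exact M1|].
  intros a. exact (proj2_sig (I a)).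
Qed.

(** The strict signs of [h] at [p a - e] and [p a + e] survive for nearby parameters [b], and
    monotonicity then traps the root [p b] between these two points. *)
Lemma implicit_continuity d h h1 (r : posreal) p a :
  (forall x y, square d x y -> continuity_2d_pt h x y) ->
  (forall x y, square d x y -> is_derive (fun z => h z y) x (h1 x y)) ->
  (forall x y, square d x y -> 0 < h1 x y) ->
  r <= d -> (forall a, Rabs a < r -> Rabs (p a) < d /\ h (p a) a = 0) ->
  Rabs a < r -> continuity_pt p a.
Proof.
  intros Hc Hd Hp Hr Hz Ha. apply continuity_pt_locally. intros eps.
  destruct (Hz a Ha) as [Hpa Ea].
  (* The second bound keeps [p a - e] and [p a + e] inside the square. *)
  set (e := Rmin eps ((d - Rabs (p a)) / 2)).
  assert (He : 0 < e) by (apply Rmin_pos; [apply cond_pos|lra]).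
  assert (M1 : e <= eps) by apply Rmin_l.
  assert (M2 : e <= (d - Rabs (p a)) / 2) by apply Rmin_r.
  assert (S : forall b, Rabs b < d -> square d (p a + e) b /\ square d (p a - e) b).
  { intros b Hb. assert (T1 := Rabs_triang (p a) e).
    assert (T2 := Rabs_triang (p a) (- e)). rewrite Rabs_Ropp in T2.
    rewrite (Rabs_pos_eq e) in T1, T2 by lra. unfold square, Rminus at 1.
    repeat split; auto; lra. }
  assert (Ha' : Rabs a < d) by lra. destruct (S a Ha') as [S1 S2].
  assert (S3 : square d (p a) a) by (split; auto).
  assert (E1 : 0 < h (p a + e) a).
  { apply Rle_lt_trans with (h (p a) a); [lra|]. apply square_increasing with d h1; auto; lra. }
  assert (E2 : h (p a - e) a < 0).
  { apply Rlt_le_trans with (h (p a) a); [|lra]. apply square_increasing with d h1; auto; lra. }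
  assert (L1 : locally a (fun b => 0 < h (p a + e) b)).
  { apply (locally_2d_1d_const_x (fun x b => 0 < h x b)), continuity_2d_pt_pos; auto. }
  assert (L2 : locally a (fun b => 0 < - h (p a - e) b)).
  { apply (locally_2d_1d_const_x (fun x b => 0 < - h x b)).
    apply (continuity_2d_pt_pos (fun x b => - h x b)); [|lra].
    now apply continuity_2d_pt_opp, Hc. }
  assert (L3 : locally a (fun b => Rabs b < r)).
  { assert (L : locally_2d (square r) 0 a).
    { apply open_square. split; auto. rewrite Rabs_R0. apply cond_pos. }
    generalize (locally_2d_1d_const_x _ _ _ L). apply filter_imp. now intros b [_ Hb]. }
  generalize (filter_and _ _ L1 (filter_and _ _ L2 L3)). apply filter_imp.
  intros b (B1 & B2 & B3). destruct (Hz b B3) as [Hpb Eb].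
  assert (Hb : Rabs b < d) by lra. destruct (S b Hb) as [T1 T2].
  assert (T3 : square d (p b) b) by (split; auto).
  apply Rabs_lt_between'.
  split; apply Rnot_le_lt; intros Hle.
  - destruct (Rle_lt_or_eq_dec (p b) (p a - e)) as [Hl|Hl]; [lra| |rewrite Hl in Eb; lra].
    assert (h (p b) b < h (p a - e) b) by (eapply square_increasing; eauto). lra.
  - destruct (Rle_lt_or_eq_dec (p a + e) (p b)) as [Hl|Hl];
      [lra| |rewrite <- Hl in Eb; lra].
    assert (h (p a + e) b < h (p b) b) by (eapply square_increasing; eauto). lra.
Qed.

(** Along the zero curve the differential gives [l1 D + l2 t = o(|D| + |t|)], where [D] is the
    increment of [p] over [t]. The unknown [D] on the right is first absorbed to get [|D| = O(|t|)],
    after which the error is [o(|t|)]. *)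
Lemma implicit_derive h l1 l2 p a :
  differentiable_pt_lim h (p a) a l1 l2 -> l1 <> 0 -> continuity_pt p a ->
  locally a (fun b => h (p b) b = 0) ->
  is_derive p a (- (l2 / l1)).
Proof.
  intros Hdiff Hl Hc Hz. apply is_derive_Reals. intros eps Heps.
  set (L := Rabs (l2 / l1)).
  assert (HL : 0 <= L) by apply Rabs_pos.
  assert (Hl1 : 0 < Rabs l1) by now apply Rabs_pos_lt.
  (* The bound [/ 2] lets [|D|] be absorbed, giving [|D| <= (2 L + 1) |t|]. Then
     [|D| + |t| <= (2 L + 2) |t|], and the second bound makes the error at most [eps / 2 * |t|]. *)
  set (e1 := Rmin (/ 2) (eps / (2 * (2 * L + 2)))).
  assert (He1 : 0 < e1).
  { apply Rmin_pos; [lra|]. apply Rdiv_lt_0_compat; lra. }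
  assert (M1 : e1 <= / 2) by apply Rmin_l.
  assert (M2 : e1 * (2 * L + 2) <= eps / 2).
  { apply Rle_trans with (eps / (2 * (2 * L + 2)) * (2 * L + 2)).
    - apply Rmult_le_compat_r; [lra|apply Rmin_r].
    - right; field; lra. }
  assert (He : 0 < e1 * Rabs l1) by now apply Rmult_lt_0_compat.
  assert (Ha := locally_singleton _ _ Hz). simpl in Ha.
  assert (Lo : locally a (fun b =>
      Rabs (h (p b) b - h (p a) a - (l1 * (p b - p a) + l2 * (b - a)))
      <= e1 * Rabs l1 * Rmax (Rabs (p b - p a)) (Rabs (b - a)))).
  { assert (Lo := locally_2d_comp _ (fun _ b => p b) (fun _ b => b) 0 a
      (Hdiff (mkposreal _ He))).
    refine (locally_2d_1d_const_x _ 0 a (Lo _ _)).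
    - apply (continuity_1d_2d_pt_comp p (fun _ b => b)); auto.
      apply continuity_2d_pt_id2.
    - apply continuity_2d_pt_id2. }
  destruct (filter_and _ _ Lo Hz) as [del Hdel].
  exists del. intros t Ht Htd.
  destruct (Hdel (a + t)) as [D1 D2].
  { unfold ball; simpl; unfold AbsRing_ball, abs, minus, plus, opp; simpl.
    now replace (a + t + - a) with t by ring. }
  replace (a + t - a) with t in D1 by ring. rewrite D2, Ha in D1.
  set (D := p (a + t) - p a) in *.
  assert (D3 : Rabs (D + l2 / l1 * t) <= e1 * (Rabs D + Rabs t)).
  { apply Rmult_le_reg_l with (Rabs l1); auto. rewrite <- Rabs_mult.
    replace (l1 * (D + l2 / l1 * t)) with (- (0 - 0 - (l1 * D + l2 * t))) by (field; auto).
    rewrite Rabs_Ropp.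
    assert (Rmax (Rabs D) (Rabs t) <= Rabs D + Rabs t).
    { assert (0 <= Rabs D) by apply Rabs_pos. assert (0 <= Rabs t) by apply Rabs_pos.
      apply Rmax_lub; lra. }
    nra. }
  assert (D4 : Rabs D <= Rabs (D + l2 / l1 * t) + L * Rabs t).
  { unfold L. rewrite <- Rabs_mult.
    replace D with (D + l2 / l1 * t + - (l2 / l1 * t)) at 1 by ring.
    rewrite <- (Rabs_Ropp (l2 / l1 * t)). apply Rabs_triang. }
  assert (Hpt : 0 < Rabs t) by now apply Rabs_pos_lt.
  assert (D5 : Rabs D <= (2 * L + 1) * Rabs t).
  { assert (0 <= Rabs D) by apply Rabs_pos. nra. }
  replace (D / t - - (l2 / l1)) with ((D + l2 / l1 * t) / t) by (field; auto).
  unfold Rdiv at 1. rewrite Rabs_mult, Rabs_inv.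
  apply Rmult_lt_reg_r with (Rabs t); auto.
  rewrite Rmult_assoc, Rinv_l, Rmult_1_r by lra.
  nra.
Qed.

(** Bootstrap: in [p' = - h2 (p a) a / h1 (p a) a] the right side is as regular as [p], so each
    order of regularity gives the next. *)
Lemma implicit_Ck d r h h1 h2 p :
  r <= d -> (forall a, Rabs a < r -> Rabs (p a) < d) ->
  (forall x y, square d x y -> h1 x y <> 0) ->
  (forall n, Ck (square d) n h1) -> (forall n, Ck (square d) n h2) ->
  (forall a, Rabs a < r -> is_derive p a (- (h2 (p a) a / h1 (p a) a))) ->
  (forall a, Rabs a < r -> h (p a) a = 0) ->
  forall n, Ck (square r) n (fun _ a => p a).
Proof.
  intros Hr Hpd Hn H1 H2 Hp Hz.
  assert (Hc : forall x a, square r x a -> continuity_2d_pt (fun _ a => p a) x a).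
  { intros x a [_ Ha]. apply (continuity_1d_2d_pt_comp p (fun _ a => a)).
    - apply derivable_continuous_pt. eexists. apply is_derive_Reals, Hp, Ha.
    - apply continuity_2d_pt_id2. }
  induction n as [|n IH]; [split; auto|].
  split; auto.
  exists (fun _ _ => 0), (fun x a => -1 * (h2 (p a) a * / h1 (p a) a)).
  split; [|split].
  - intros x a [_ Ha]. split.
    + apply (is_derive_const (K := R_AbsRing) (V := R_NormedModule)).
    + replace (-1 * _) with (- (h2 (p a) a / h1 (p a) a)) by (unfold Rdiv; ring).
      now apply Hp.
  - apply Ck_const.
  - assert (S : forall x a, square r x a -> square d (p a) a).
    { intros x a [_ Ha]. split; auto; lra. }
    apply Ck_mult; [apply Ck_const|]. apply Ck_mult.
    + apply (Ck_comp (square r) (square d) n h2 (fun _ a => p a) (fun _ a => a));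
        auto using open_square, Ck_snd.
    + apply Ck_inv.
      * intros x a Hxa. apply Hn. eauto.
      * apply (Ck_comp (square r) (square d) n h1 (fun _ a => p a) (fun _ a => a));
        auto using open_square, Ck_snd.
Qed.

(** * Germs at the origin *)

(** The square is chosen before the order [n], as [smooth2_near] requires. *)
Definition smooth_germ (h : R -> R -> R) : Prop :=
  exists d : posreal, forall n, Ck (square d) n h.

Lemma smooth_germ_near h (P : R -> R -> Prop) :
  smooth_germ h -> locally_2d P 0 0 ->
  exists d : posreal, (forall n, Ck (square d) n h) /\
    forall x y, square d x y -> P x y.
Proof.
  intros [d1 H1] H. apply locally_2d_square in H. destruct H as [d2 H2].
  assert (Hm : 0 < Rmin d1 d2) by (apply Rmin_pos; apply cond_pos).
  assert (M1 := Rmin_l d1 d2). assert (M2 := Rmin_r d1 d2).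
  exists (mkposreal _ Hm); simpl. split.
  - intros n. apply Ck_subset with (square d1); auto.
    intros x y [Hx Hy]; split; lra.
  - intros x y [Hx Hy]; apply H2; split; lra.
Qed.

Lemma square_0 (d : posreal) : square d 0 0.
Proof. split; rewrite Rabs_R0; apply cond_pos. Qed.

Lemma smooth_germ_continuity h : smooth_germ h -> continuity_2d_pt h 0 0.
Proof.
  intros [d H]. apply Ck_continuity with (square d) 0%nat; auto using square_0.
Qed.

Lemma smooth_germ_ext h h' :
  locally_2d (fun x y => h x y = h' x y) 0 0 -> smooth_germ h -> smooth_germ h'.
Proof.
  intros He Hh. destruct (smooth_germ_near _ _ Hh He) as (d & H & E).
  exists d. intros n. apply Ck_ext with h; auto using open_square.
Qed.

Lemma smooth_germ_const c : smooth_germ (fun _ _ => c).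
Proof. exists (mkposreal 1 Rlt_0_1); auto using Ck_const. Qed.

Lemma smooth_germ_fst : smooth_germ (fun x _ => x).
Proof. exists (mkposreal 1 Rlt_0_1); auto using Ck_fst. Qed.

Lemma smooth_germ_snd : smooth_germ (fun _ y => y).
Proof. exists (mkposreal 1 Rlt_0_1); auto using Ck_snd. Qed.

Lemma smooth_germ_pair h k :
  smooth_germ h -> smooth_germ k ->
  exists d : posreal, forall n, Ck (square d) n h /\ Ck (square d) n k.
Proof.
  intros [d1 H1] [d2 H2].
  assert (Hm : 0 < Rmin d1 d2) by (apply Rmin_pos; apply cond_pos).
  assert (M1 := Rmin_l d1 d2). assert (M2 := Rmin_r d1 d2).
  exists (mkposreal _ Hm); simpl. intros n; split;
    [apply Ck_subset with (square d1) | apply Ck_subset with (square d2)]; auto;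
    intros x y [Hx Hy]; split; lra.
Qed.

Lemma smooth_germ_plus h k :
  smooth_germ h -> smooth_germ k -> smooth_germ (fun x y => h x y + k x y).
Proof.
  intros Hh Hk. destruct (smooth_germ_pair _ _ Hh Hk) as [d H].
  exists d. intros n. now apply Ck_plus; apply H.
Qed.

Lemma smooth_germ_mult h k :
  smooth_germ h -> smooth_germ k -> smooth_germ (fun x y => h x y * k x y).
Proof.
  intros Hh Hk. destruct (smooth_germ_pair _ _ Hh Hk) as [d H].
  exists d. intros n. now apply Ck_mult; apply H.
Qed.

Lemma smooth_germ_inv h :
  smooth_germ h -> h 0 0 <> 0 -> smooth_germ (fun x y => / h x y).
Proof.
  intros Hh H0.
  destruct (smooth_germ_near _ _ Hh
    (continuity_2d_pt_neq_0 _ _ _ (smooth_germ_continuity _ Hh) H0)) as (d & H & N).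
  exists d. intros n. now apply Ck_inv.
Qed.

Lemma smooth_germ_locally_2d_comp P u v :
  smooth_germ u -> smooth_germ v -> u 0 0 = 0 -> v 0 0 = 0 ->
  locally_2d P 0 0 -> locally_2d (fun x y => P (u x y) (v x y)) 0 0.
Proof.
  intros Hu Hv Eu Ev HP. apply locally_2d_comp.
  - now rewrite Eu, Ev.
  - now apply smooth_germ_continuity.
  - now apply smooth_germ_continuity.
Qed.

Lemma smooth_germ_comp h u v :
  smooth_germ h -> smooth_germ u -> smooth_germ v -> u 0 0 = 0 -> v 0 0 = 0 ->
  smooth_germ (fun x y => h (u x y) (v x y)).
Proof.
  intros [e He] Hu Hv Eu Ev.
  assert (L : locally_2d (square e) 0 0) by (apply open_square, square_0).
  apply (smooth_germ_locally_2d_comp _ _ _ Hu Hv Eu Ev) in L.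
  destruct (smooth_germ_pair _ _ Hu Hv) as [d1 H1].
  apply locally_2d_square in L. destruct L as [d2 H2].
  assert (Hm : 0 < Rmin d1 d2) by (apply Rmin_pos; apply cond_pos).
  assert (M1 := Rmin_l d1 d2). assert (M2 := Rmin_r d1 d2).
  exists (mkposreal _ Hm); simpl. intros n.
  assert (S : forall x y, square (Rmin d1 d2) x y -> square d1 x y /\ square d2 x y).
  { intros x y [Hx Hy]; repeat split; lra. }
  apply Ck_comp with (square e); auto using open_square.
  - intros x y Hxy. now apply H2, S.
  - apply Ck_subset with (square d1); [|apply H1]. intros; now apply S.
  - apply Ck_subset with (square d1); [|apply H1]. intros; now apply S.
Qed.

Lemma smooth2_near_of_germ h : smooth_germ h -> smooth2_near h 0 0.
Proof.
  intros [d H]. apply locally_2d_square. exists d. intros x y Hxy n.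
  apply ex_diff_n_of_Ck with (square d); auto using open_square.
Qed.

Lemma smooth_germ_of_smooth2 h : smooth2 h -> smooth_germ h.
Proof.
  intros H. exists (mkposreal 1 Rlt_0_1). intros n.
  apply Ck_of_ex_diff_n. intros; apply H.
Qed.

(** [Derive_n p (S k)] is by definition the second partial derivative of
    [fun _ y => Derive_n p k y], so [Ck_partials] can be iterated on a fixed square. *)
Lemma smooth_near_of_germ p : smooth_germ (fun _ y => p y) -> smooth_near p 0.
Proof.
  intros [d H].
  assert (K : forall k n, Ck (square d) n (fun _ y => Derive_n p k y)).
  { induction k as [|k IH]; [exact H|].
    apply (Ck_partials (square d) (fun _ y => Derive_n p k y)); auto using open_square. }
  assert (L : locally_2d (square d) 0 0) by (apply open_square, square_0).
  unfold smooth_near. generalize (locally_2d_1d_const_x _ _ _ L). apply filter_imp.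
  intros y Hy [|k]; [exact I|].
  destruct (Ck_partials (square d) (fun _ y => Derive_n p k y)) as [D _];
    auto using open_square.
  destruct (D 0 y Hy) as [_ D2]. eexists; exact D2.
Qed.

Lemma smooth_germ_hadamard h :
  smooth_germ h ->
  exists q, smooth_germ q /\ q 0 0 = partial1 h 0 0 /\
    locally_2d (fun x y => h x y = h 0 y + x * q x y) 0 0.
Proof.
  intros [d H]. destruct (Ck_partials _ _ (open_square d) H) as (D & H1 & _).
  exists (moment 0 (partial1 h)). split; [|split].
  - exists d. intros n. now apply Ck_moment.
  - apply moment_0_at_0.
  - apply locally_2d_square. exists d. intros x y Hxy.
    apply moment_0_spec with d; auto.
    + intros. now apply Ck_continuity with (square d) 0%nat.
    + intros. now apply D.
Qed.

Lemma implicit_function_pos h :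
  smooth_germ h -> h 0 0 = 0 -> 0 < partial1 h 0 0 ->
  exists p : R -> R, p 0 = 0 /\ smooth_germ (fun _ y => p y) /\
    is_derive p 0 (- (partial2 h 0 0 / partial1 h 0 0)) /\
    locally_2d (fun _ y => h (p y) y = 0) 0 0 /\
    locally_2d (fun x y => h x y = 0 -> x = p y) 0 0.
Proof.
  intros Hh H0 Hp.
  assert (Lp : locally_2d (fun x y => 0 < partial1 h x y) 0 0).
  { apply continuity_2d_pt_pos; auto. destruct Hh as [d H].
    destruct (Ck_partials _ _ (open_square d) H) as (_ & H1 & _).
    apply Ck_continuity with (square d) 0%nat; auto using square_0. }
  destruct (smooth_germ_near _ _ Hh Lp) as (d & H & P).
  destruct (Ck_partials _ _ (open_square d) H) as (D & H1 & H2).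
  assert (C : forall x y, square d x y -> continuity_2d_pt h x y).
  { intros. now apply Ck_continuity with (square d) 0%nat. }
  assert (D1 : forall x y, square d x y -> is_derive (fun z => h z y) x (partial1 h x y)).
  { intros; now apply D. }
  destruct (implicit_exists d h (partial1 h)) as (r & p & Hr & Hz); auto.
  assert (U : forall x y, square r x y -> h x y = 0 -> x = p y).
  { intros x y [Hx Hy] E. destruct (Hz y Hy) as [Hpy Ey].
    assert (square d x y) by (split; lra).
    assert (square d (p y) y) by (split; auto; lra).
    destruct (Rtotal_order x (p y)) as [Hl|[Hl|Hl]]; auto.
    - assert (h x y < h (p y) y) by (eapply square_increasing; eauto). lra.
    - assert (h (p y) y < h x y) by (eapply square_increasing; eauto). lra. }
  assert (Dp : forall a, Rabs a < r ->
    is_derive p a (- (partial2 h (p a) a / partial1 h (p a) a))).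
  { intros a Ha. destruct (Hz a Ha) as [Hpa Ea].
    assert (S : square d (p a) a) by (split; auto; lra).
    apply implicit_derive with h.
    - apply differentiable_of_partials with (square d); auto using open_square.
      now apply Ck_continuity with (square d) 0%nat.
    - specialize (P _ _ S). lra.
    - apply implicit_continuity with d h (partial1 h) r; auto.
    - assert (L : locally_2d (square r) 0 a).
      { apply open_square. split; auto. rewrite Rabs_R0; apply cond_pos. }
      generalize (locally_2d_1d_const_x _ _ _ L). apply filter_imp.
      intros b [_ Hb]. now apply Hz. }
  assert (R0 : Rabs 0 < r) by (rewrite Rabs_R0; apply cond_pos).
  (* The construction of [p] does not prescribe [p 0]; uniqueness of the root at parameter 0
     does. *)
  assert (p0 : p 0 = 0) by (symmetry; apply U; auto using square_0).
  exists p. split; [|split; [|split; [|split]]].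
  - exact p0.
  - exists r. apply implicit_Ck with d h (partial1 h) (partial2 h); auto.
    + intros; now apply Hz.
    + intros x y S. specialize (P _ _ S). lra.
    + intros; now apply Hz.
  - specialize (Dp 0 R0). now rewrite p0 in Dp.
  - apply locally_2d_square. exists r. intros x y [_ Hy]. now apply Hz.
  - apply locally_2d_square. exists r. exact U.
Qed.

(** Passing to [- h] changes neither the zero set nor the quotient of the partial derivatives, which
    reduces a negative slope to a positive one. *)
Lemma implicit_function h :
  smooth_germ h -> h 0 0 = 0 -> partial1 h 0 0 <> 0 ->
  exists p : R -> R, p 0 = 0 /\ smooth_germ (fun _ y => p y) /\
    is_derive p 0 (- (partial2 h 0 0 / partial1 h 0 0)) /\
    locally_2d (fun _ y => h (p y) y = 0) 0 0 /\
    locally_2d (fun x y => h x y = 0 -> x = p y) 0 0.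
Proof.
  intros Hh H0 Hn.
  destruct (Rdichotomy _ _ Hn) as [Hneg|Hpos]; [|now apply implicit_function_pos].
  assert (E1 : partial1 (fun x y => - h x y) 0 0 = - partial1 h 0 0).
  { apply Derive_opp. }
  assert (E2 : partial2 (fun x y => - h x y) 0 0 = - partial2 h 0 0).
  { apply Derive_opp. }
  destruct (implicit_function_pos (fun x y => - h x y)) as (p & p0 & Hs & Hd & Hz & Hu).
  - apply smooth_germ_ext with (fun x y => -1 * h x y).
    + apply locally_2d_forall; intros; ring.
    + apply smooth_germ_mult; auto using smooth_germ_const.
  - lra.
  - lra.
  - exists p. split; [|split; [|split; [|split]]]; auto.
    + rewrite E1, E2 in Hd.
      replace (partial2 h 0 0 / partial1 h 0 0)
        with (- partial2 h 0 0 / - partial1 h 0 0) by (field; auto).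
      exact Hd.
    + generalize Hz; apply locally_2d_impl, locally_2d_forall; intros; lra.
    + generalize Hu; apply locally_2d_impl, locally_2d_forall; intros u v K E.
      apply K; lra.
Qed.

(** * Reduction to the normal form *)

Lemma smooth_germ_differentiable h :
  smooth_germ h -> differentiable_pt_lim h 0 0 (partial1 h 0 0) (partial2 h 0 0).
Proof.
  intros [d H]. destruct (Ck_partials _ _ (open_square d) H) as (D & H1 & _).
  apply differentiable_of_partials with (square d); auto using open_square, square_0.
  apply Ck_continuity with (square d) 0%nat; auto using square_0.
Qed.

Lemma smooth_germ_ex_derive p : smooth_germ (fun _ y => p y) -> ex_derive p 0.
Proof.
  intros [d H]. destruct (Ck_partials _ _ (open_square d) H) as (D & _).
  destruct (D 0 0 (square_0 d)) as [_ D2]. eexists; exact D2.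
Qed.

(** The term containing [u'] carries the factor [b 0 = 0], so the derivative of [u] never has to be
    computed. *)
Lemma is_derive_mult_vanishing b u l :
  b 0 = 0 -> is_derive b 0 l -> ex_derive u 0 ->
  is_derive (fun y => b y * u y) 0 (l * u 0).
Proof.
  intros H0 Hb [l' Hu].
  replace (l * u 0) with (plus (mult l (u 0)) (mult (b 0) l')).
  - apply (is_derive_mult b u); auto. intros; apply Rmult_comm.
  - rewrite H0. unfold plus, mult; simpl. ring.
Qed.

(** The inverse is the implicit solution [x = A y] of [B x - y = 0]: solvability gives
    [B (A y) = y], and uniqueness applied to the pair [(y, B y)] gives [A (B y) = y]. *)
Lemma inverse_function B l :
  smooth_germ (fun _ y => B y) -> B 0 = 0 -> is_derive B 0 l -> l <> 0 ->
  exists A : R -> R, A 0 = 0 /\ smooth_germ (fun _ y => A y) /\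
    locally_2d (fun _ y => A (B y) = y) 0 0 /\ locally_2d (fun _ y => B (A y) = y) 0 0.
Proof.
  intros HB B0 Bd Hl.
  destruct (implicit_function (fun x y => B x + -1 * y)) as (A & A0 & HA & _ & Hz & Hu).
  - apply smooth_germ_plus.
    + apply (smooth_germ_comp (fun _ y => B y) (fun x _ => x) (fun x _ => x));
        auto using smooth_germ_fst.
    + apply smooth_germ_mult; auto using smooth_germ_const, smooth_germ_snd.
  - rewrite B0; ring.
  - unfold partial1. replace (Derive _ 0) with l; auto.
    symmetry. apply is_derive_unique.
    replace l with (plus l 0) by apply Rplus_0_r.
    apply (is_derive_plus (K := R_AbsRing) (V := R_NormedModule)); auto.
    apply (is_derive_const (K := R_AbsRing) (V := R_NormedModule)).
  - exists A. split; [|split; [|split]]; auto.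
    + apply (smooth_germ_locally_2d_comp _ (fun _ y => y) (fun _ y => B y)) in Hu;
        auto using smooth_germ_snd.
      generalize Hu. apply locally_2d_impl, locally_2d_forall.
      intros _ y E. symmetry. apply E; ring.
    + generalize Hz. apply locally_2d_impl, locally_2d_forall. intros; lra.
Qed.

Lemma smooth_germ_at_fst_0 h :
  smooth_germ h -> smooth_germ (fun _ y => h 0 y).
Proof.
  intros Hh. apply (smooth_germ_comp h (fun _ _ => 0) (fun _ y => y));
    auto using smooth_germ_const, smooth_germ_snd.
Qed.

Lemma smooth_germ_shift h p :
  smooth_germ h -> smooth_germ (fun _ y => p y) -> p 0 = 0 ->
  smooth_germ (fun x y => h (p y + x) y) /\
  partial1 (fun x y => h (p y + x) y) 0 0 = partial1 h 0 0.
Proof.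
  intros Hh Hp p0. split.
  - apply (smooth_germ_comp h (fun x y => p y + x) (fun _ y => y));
      auto using smooth_germ_plus, smooth_germ_fst, smooth_germ_snd.
    rewrite p0; ring.
  - unfold partial1. apply Derive_ext. intros t. now rewrite p0, Rplus_0_l.
Qed.

(* The zero of [g (., y)] is moved to the origin and [g] is divided out; expanding
   [f] and [w] separately gives the linear coefficient at the origin without
   differentiating a quotient. *)
Lemma solved_form f g :
  smooth_germ f -> smooth_germ g -> f 0 0 = 0 -> g 0 0 = 0 ->
  partial1 g 0 0 <> 0 ->
  partial1 g 0 0 * partial2 f 0 0 - partial1 f 0 0 * partial2 g 0 0 <> 0 ->
  exists (p b c : R -> R) (w q : R -> R -> R) (l : R),
    smooth_germ (fun _ y => p y) /\ p 0 = 0 /\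
    smooth_germ (fun _ y => b y) /\ b 0 = 0 /\ is_derive b 0 l /\ l <> 0 /\
    smooth_germ (fun _ y => c y) /\ c 0 = partial1 f 0 0 / partial1 g 0 0 /\
    smooth_germ w /\ w 0 0 <> 0 /\ smooth_germ q /\
    locally_2d (fun x y => w x y * g (p y + x) y = x /\
      w x y * f (p y + x) y = b y + x * (c y + x * q x y)) 0 0.
Proof.
  intros Hf Hg f0 g0 gx HA.
  destruct (implicit_function g Hg g0 gx) as (p & p0 & Hp & Dp & Zp & _).
  destruct (smooth_germ_shift g p Hg Hp p0) as [Hgs gsx].
  destruct (smooth_germ_shift f p Hf Hp p0) as [Hfs fsx].
  destruct (smooth_germ_hadamard _ Hgs) as (G & HG & G0 & EG).
  destruct (smooth_germ_hadamard _ Hfs) as (F & HF & F0 & EF).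
  rewrite gsx in G0. rewrite fsx in F0.
  assert (NG : G 0 0 <> 0) by now rewrite G0.
  assert (Hw := smooth_germ_inv _ HG NG).
  destruct (smooth_germ_hadamard _ Hw) as (w1 & Hw1 & _ & Ew).
  (* [phi] is [f] on the zero curve of [g]. The form [p y + 0] matches the shifted [f] at
     [x = 0]. *)
  set (phi := fun y => f (p y + 0) y).
  assert (Hphi : smooth_germ (fun _ y => phi y)).
  { apply (smooth_germ_at_fst_0 _ Hfs). }
  assert (phi0 : phi 0 = 0) by (unfold phi; now rewrite p0, Rplus_0_r).
  (* From [f = phi + x F] and [/ G = / G 0 y + x w1] the product is
     [phi / G 0 y + x (phi w1 + F / G)]. Expanding this last bracket once more in [x] yields [c] and
     [q]. *)
  assert (HQ : smooth_germ (fun x y => phi y * w1 x y + F x y * / G x y)).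
  { apply smooth_germ_plus; apply smooth_germ_mult; auto. }
  destruct (smooth_germ_hadamard _ HQ) as (q & Hq & _ & Eq).
  assert (Hw0 := smooth_germ_at_fst_0 _ Hw).
  exists p, (fun y => phi y * / G 0 y), (fun y => phi y * w1 0 y + F 0 y * / G 0 y),
    (fun x y => / G x y), q,
    ((partial1 f 0 0 * - (partial2 g 0 0 / partial1 g 0 0) + partial2 f 0 0 * 1)
      * / G 0 0).
  split; [exact Hp|]. split; [exact p0|].
  split; [now apply smooth_germ_mult|].
  split; [rewrite phi0; ring|].
  split.
  (* Since [phi 0 = 0], only [phi' 0] matters. It comes from the chain rule along the zero curve,
     with the slope of [p] supplied by the implicit function theorem. *)
  { apply (is_derive_mult_vanishing phi (fun y => / G 0 y)); auto.
    2: now apply smooth_germ_ex_derive.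
    apply is_derive_Reals.
    apply (derivable_pt_lim_comp_2d f (fun y => p y + 0) (fun y => y)).
    - rewrite p0, Rplus_0_r. now apply smooth_germ_differentiable.
    - apply is_derive_Reals. apply is_derive_ext with p; auto. intros; now rewrite Rplus_0_r.
    - apply derivable_pt_lim_id. }
  split.
  { rewrite G0. intros E. apply HA.
    replace (partial1 g 0 0 * partial2 f 0 0 - partial1 f 0 0 * partial2 g 0 0)
      with ((partial1 f 0 0 * - (partial2 g 0 0 / partial1 g 0 0) + partial2 f 0 0 * 1)
              * / partial1 g 0 0 * (partial1 g 0 0 * partial1 g 0 0)) by (field; auto).
    rewrite E; ring. }
  split; [apply (smooth_germ_at_fst_0 _ HQ)|].
  split; [rewrite phi0, F0, G0; unfold Rdiv; ring|].
  split; [exact Hw|]. split; [now apply Rinv_neq_0_compat|]. split; [exact Hq|].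
  assert (LG := continuity_2d_pt_neq_0 _ _ _ (smooth_germ_continuity _ HG) NG).
  generalize (locally_2d_and _ _ _ _ LG (locally_2d_and _ _ _ _ Zp
    (locally_2d_and _ _ _ _ EG (locally_2d_and _ _ _ _ EF (locally_2d_and _ _ _ _ Ew Eq))))).
  apply locally_2d_impl, locally_2d_forall.
  intros x y (N & Z & e1 & e2 & e3 & e4). simpl in *.
  rewrite Rplus_0_r, Z in e1. split.
  - rewrite e1. now field.
  - rewrite <- e4, e2. fold (phi y). rewrite e3. ring.
Qed.

Theorem proposition2p8 (f g : R -> R -> R)
  (f_smooth : smooth2 f) (g_smooth : smooth2 g)
  (f0 : f 0 0 = 0) (g0 : g 0 0 = 0)
  (fx : partial1 f 0 0 <> 0) (gx : partial1 g 0 0 <> 0)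
  (A_neq0 : partial1 g 0 0 * partial2 f 0 0 - partial1 f 0 0 * partial2 g 0 0 <> 0) :
  let s := sign (partial1 f 0 0 / partial1 g 0 0) in
  (s = 1 \/ s = -1) /\
  exists r : R -> R -> R,
    smooth_O_eta2 r /\ brought_near_origin_to (Qdae g f) (normal_form s r).
Proof.
  intros s.
  assert (Hs : s = 1 \/ s = -1).
  { assert (N : partial1 f 0 0 / partial1 g 0 0 <> 0).
    { apply Rmult_integral_contrapositive_currified; auto. now apply Rinv_neq_0_compat. }
    destruct (Rdichotomy _ _ N);
      [right; now apply sign_eq_m1 | left; now apply sign_eq_1]. }
  split; [exact Hs|].
  assert (ss : s * s = 1) by (destruct Hs as [-> | ->]; ring).
  destruct (solved_form f g) as (p & b & c & w & q & l & Hp & p0 & Hb & b0 & Db & Nl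
    & Hc & c0 & Hw & Nw & Hq & E); auto using smooth_germ_of_smooth2.
  (* At the origin this is the absolute value of [f_x / g_x]. *)
  set (k := fun y => s * c y).
  assert (Hk : smooth_germ (fun _ y => k y)).
  { apply smooth_germ_mult; auto using smooth_germ_const. }
  assert (Nk : k 0 <> 0).
  { unfold k; rewrite c0. unfold Rdiv. repeat apply Rmult_integral_contrapositive_currified;
      auto; [destruct Hs; lra | now apply Rinv_neq_0_compat]. }
  assert (Lk := continuity_2d_pt_neq_0 _ _ _ (smooth_germ_continuity _ Hk) Nk).
  assert (Hik : smooth_germ (fun _ y => / k y)) by now apply smooth_germ_inv.
  assert (Hikk : smooth_germ (fun _ y => / k y * / k y)) by now apply smooth_germ_mult.
  set (B := fun y => b y * (/ k y * / k y)).
  assert (HB : smooth_germ (fun _ y => B y)) by now apply smooth_germ_mult.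
  assert (B0 : B 0 = 0) by (unfold B; rewrite b0; ring).
  assert (DB : is_derive B 0 (l * (/ k 0 * / k 0))).
  { apply (is_derive_mult_vanishing b (fun y => / k y * / k y)); auto.
    now apply smooth_germ_ex_derive. }
  destruct (inverse_function B _ HB B0 DB) as (A & A0 & HA & EAB & EBA).
  { repeat apply Rmult_integral_contrapositive_currified; auto;
      now apply Rinv_neq_0_compat. }
  assert (HkA : smooth_germ (fun eta y => k (A y) * eta)).
  { apply smooth_germ_mult; auto using smooth_germ_fst.
    apply (smooth_germ_comp (fun _ y => k y) (fun x _ => x) (fun _ y => A y));
      auto using smooth_germ_fst. }
  assert (HqA : smooth_germ (fun eta y => q (k (A y) * eta) (A y))).
  { apply (smooth_germ_comp q (fun eta y => k (A y) * eta) (fun _ y => A y)); auto; ring. }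
  assert (Hke : smooth_germ (fun eta y => k y * eta)).
  { apply smooth_germ_mult; auto using smooth_germ_fst. }
  (* Here [y] is the new parameter [beta], so the old one is recovered as [A y]. *)
  exists (fun eta y => eta ^ 2 * q (k (A y) * eta) (A y)). split.
  { split.
    - apply smooth2_near_of_germ, smooth_germ_mult; auto.
      apply (smooth_germ_mult (fun x _ => x) (fun x _ => x * 1));
        auto using smooth_germ_mult, smooth_germ_fst, smooth_germ_const.
    (* Continuity at the origin with tolerance 1 bounds the factor of [eta ^ 2]; the arguments stay
       unsimplified to match the continuity statement. *)
    - exists (Rabs (q (k (A 0) * 0) (A 0)) + 1).
      generalize (smooth_germ_continuity _ HqA (mkposreal 1 Rlt_0_1)).
      apply locally_2d_impl, locally_2d_forall. simpl. intros x y H.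
      rewrite Rabs_mult, (Rabs_pos_eq (x * (x * 1))) by nra.
      rewrite Rmult_comm. apply Rmult_le_compat_r; [nra|].
      generalize (Rabs_triang_inv (q (k (A y) * x) (A y)) (q (k (A 0) * 0) (A 0))). lra. }
  (* The factor [w] turns [g] into [xi = k eta], and the chain rule contributes another [k];
     dividing by [k^2] leaves [eta] as leading coefficient. *)
  exists (fun eta y => p y + k y * eta), B,
    (fun eta y => w (k y * eta) y * (/ k y * / k y)).
  split; [|split; [|split; [|split]]].
  - split; [rewrite p0; ring|].
    split; [apply smooth2_near_of_germ; now apply smooth_germ_plus|].
    exists (fun x y => (x + -1 * p y) * / k y). split; [|split].
    + apply smooth2_near_of_germ, smooth_germ_mult; auto.
      apply smooth_germ_plus; auto using smooth_germ_fst.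
      apply smooth_germ_mult; auto using smooth_germ_const.
    + generalize Lk. apply locally_2d_impl, locally_2d_forall. intros; now field.
    + generalize Lk. apply locally_2d_impl, locally_2d_forall. intros; now field.
  - split; [exact B0|]. split; [now apply smooth_near_of_germ|].
    exists A. split; [now apply smooth_near_of_germ|]. split.
    + exact (locally_2d_1d_const_x _ _ _ EAB).
    + exact (locally_2d_1d_const_x _ _ _ EBA).
  - apply smooth2_near_of_germ, smooth_germ_mult; auto.
    apply (smooth_germ_comp w (fun eta y => k y * eta) (fun _ y => y));
      auto using smooth_germ_snd; ring.
  - assert (Lw := continuity_2d_pt_neq_0 _ _ _ (smooth_germ_continuity _ Hw) Nw).
    apply (smooth_germ_locally_2d_comp _ (fun eta y => k y * eta) (fun _ y => y)) in Lw;
      auto using smooth_germ_snd; try ring.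
    generalize (locally_2d_and _ _ _ _ Lk Lw).
    apply locally_2d_impl, locally_2d_forall. intros x y [N1 N2].
    repeat apply Rmult_integral_contrapositive_currified; auto;
      now apply Rinv_neq_0_compat.
  - apply (smooth_germ_locally_2d_comp _ (fun eta y => k y * eta) (fun _ y => y)) in E;
      auto using smooth_germ_snd; try ring.
    generalize (locally_2d_and _ _ _ _ Lk (locally_2d_and _ _ _ _ EAB E)).
    apply locally_2d_impl, locally_2d_forall. intros x y (N & EA & E1 & E2).
    simpl.
    (* This uses [s * s = 1] and turns the linear coefficient [c / k] into [s]. *)
    assert (ck : c y = s * k y) by (unfold k; rewrite <- Rmult_assoc, ss; ring).
    replace (partial1 (fun eta y => p y + k y * eta) x y) with (k y).
    2: { symmetry. apply is_derive_unique. auto_derive; auto; ring. }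
    (* The normal form is evaluated at [B y], where [A (B y) = y] returns the remainder to the
       original parameter. *)
    rewrite EA. split.
    + transitivity (w (k y * x) y * g (p y + k y * x) y * / k y); [now field|].
      rewrite E1. now field.
    + transitivity (w (k y * x) y * f (p y + k y * x) y * (/ k y * / k y)); [ring|].
      rewrite E2, ck. unfold B. now field.
Qed.
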